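(* Let the functions $\lambda_i:[0,1]\to[0,1]$, $i=1,\dots,n$, satisfy (A1)–(A3), and let $x^\ast\in\Sigma$ denote the KKT point, i.e. the unique $x^\ast\in\Sigma$ with $x_i^\ast\lambda_i(x_i^\ast)=x_j^\ast\lambda_j(x_j^\ast)$ for all $i,j\in\{1,\dots,n\}$. Consider the nonhomogeneous Markov chain $z(k)=(x(k),\bar x(k))$ on $\Sigma^2$ with long-term averaging and place-dependent probabilities described in the context. Then for any initial condition $z(0)=(x_0,\bar x_0)\in\Sigma^2$ the second component of $z(k)$ satisfies $$\lim_{k\to\infty}\bar x(k)=x^\ast\qquad\text{almost surely.}$$
   Context: Let $n\ge 2$, $\Sigma=\{x\in\mathbb{R}^n: x_i\ge 0,\ \sum_{i=1}^n x_i=1\}$, $\mathrm{ri}\,\Sigma=\{x\in\Sigma: x_i>0\ \forall i\}$, $e=(1,\dots,1)^\top$. AIMD matrices: fix $\alpha\in\mathrm{ri}\,\Sigma$ and $\beta\in(0,1)^n$ such that $\alpha_i/(1-\beta_i)$ is independent of $i$. Let $B=\{\tilde\beta\in\mathbb{R}^n:\tilde\beta_i\in\{\beta_i,1\}\ \forall i\}$ and $\mathcal{A}=\{\mathrm{diag}(\tilde\beta)+\alpha(e-\tilde\beta)^\top:\tilde\beta\in B\}$. These are column stochastic matrices. Assumptions on $\lambda_i:[0,1]\to[0,1]$, $i=1,\dots,n$: (A1) each $\lambda_i$ is continuous; (A2) $r\mapsto r\lambda_i(r)$ is strictly increasing on $[0,1]$ for each $i$; (A3) there is a constant $\lambda_{\min}>0$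 with $\lambda_i(r)\ge\lambda_{\min}$ for all $r\in[0,1]$ and all $i$. For $y\in\Sigma$ and the matrix $A\in\mathcal{A}$ corresponding to $\tilde\beta\in B$ put $p_A(y)=\prod_{i:\tilde\beta_i=\beta_i}\lambda_i(y_i)\prod_{i:\tilde\beta_i=1}(1-\lambda_i(y_i))$ (the agents respond independently, agent $i$ with probability $\lambda_i(y_i)$). The Markov chain: for $k=0,1,2,\dots$, $$x(k+1)=A(k)x(k),\qquad \bar x(k+1)=\tfrac{1}{k+2}A(k)x(k)+\tfrac{k+1}{k+2}\bar x(k),$$ where, conditionally on the past up to time $k$, $A(k)\in\mathcal{A}$ is random with $\mathbb{P}(A(k)=A\mid \bar x(k)=y)=p_A(y)$ for each $A\in\mathcal{A}$. ''Almost surely'' refers to the probability measure on sample paths induced by the chain with the given initial condition. (When $\bar x_0=x_0$, $\bar x(k)=\frac1{k+1}\sum_{j=0}^k x(j)$.) Under (A1)–(A3) the point $x^\ast$ exists and is unique. *)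

(* Defs.v *)
From HB Require Import structures.
From mathcomp Require Export all_boot all_order all_algebra.
From mathcomp Require Export all_classical all_reals all_analysis.

Set Implicit Arguments.
Unset Strict Implicit.
Unset Printing Implicit Defensive.

Import Order.TTheory GRing.Theory Num.Theory.
Import numFieldNormedType.Exports.

Local Open Scope classical_set_scope.
Local Open Scope ring_scope.

Definition simplex (R : realType) (n : nat) : set 'cV[R]_n :=
  [set x | (forall i, 0 <= x i 0) /\ \sum_(i < n) x i 0 = 1].

Definition ri_simplex (R : realType) (n : nat) : set 'cV[R]_n :=
  [set x | simplex x /\ forall i, 0 < x i 0].

Record aimd_parameters (R : realType) (n : nat) (alpha beta : 'cV[R]_n) :
    Prop := {
  alpha_ri : ri_simplex alpha;
  beta_itv : forall i, 0 < beta i 0 < 1;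
  alpha_beta_ratio : forall i j,
    alpha i 0 / (1 - beta i 0) = alpha j 0 / (1 - beta j 0) }.

Definition aimd_B (R : realType) (n : nat) (beta : 'cV[R]_n) : set 'cV[R]_n :=
  [set bt | forall i, bt i 0 = beta i 0 \/ bt i 0 = 1].

Definition aimd_mx (R : realType) (n : nat) (alpha bt : 'cV[R]_n) : 'M[R]_n :=
  diag_mx bt^T + alpha *m (const_mx 1 - bt)^T.

Definition aimd_A (R : realType) (n : nat) (alpha beta : 'cV[R]_n) :
    set 'M[R]_n :=
  [set aimd_mx alpha bt | bt in aimd_B beta].

(* The response functions live on [0, 1]; their values elsewhere are
   unconstrained and irrelevant. *)
Record response_assumptions (R : realType) (n : nat) (lambda : 'I_n -> R -> R) :
    Prop := {
  lambda_itv : forall i r, 0 <= r <= 1 -> 0 <= lambda i r <= 1;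
  lambda_continuous : forall i, {within `[0, 1], continuous (lambda i)};
  lambda_increasing : forall i r s, 0 <= r -> r < s -> s <= 1 ->
    r * lambda i r < s * lambda i s;
  lambda_bounded_below : exists2 lmin : R, 0 < lmin &
    forall i r, 0 <= r <= 1 -> lmin <= lambda i r }.

(* p_A(y) for the matrix A = aimd_mx alpha bt; for bt in B, the map
   bt |-> aimd_mx alpha bt is injective as soon as alpha i 0 < 1 for all i,
   so indexing by bt or by A is the same. *)
Definition response_prob (R : realType) (n : nat) (lambda : 'I_n -> R -> R)
    (beta bt y : 'cV[R]_n) : R :=
  (\prod_(i < n | bt i 0 == beta i 0) lambda i (y i 0)) *
  (\prod_(i < n | bt i 0 == 1) (1 - lambda i (y i 0))).

Definition kkt_point (R : realType) (n : nat) (lambda : 'I_n -> R -> R)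
    (xs : 'cV[R]_n) : Prop :=
  simplex xs /\
  forall i j, xs i 0 * lambda i (xs i 0) = xs j 0 * lambda j (xs j 0).

(* The past z(0) = h 0, ..., z(k) = h k of the chain z = (x, xbar). *)
Definition past_event (R : realType) (n : nat) (T : Type)
    (x xbar : nat -> T -> 'cV[R]_n) (k : nat)
    (h : nat -> 'cV[R]_n * 'cV[R]_n) : set T :=
  [set w | forall j, (j <= k)%N -> (x j w, xbar j w) = h j].

(* Since the initial condition is deterministic and the set of matrices is
   finite, (z(0), ..., z(k)) takes finitely many values, so conditioning on the
   past amounts to conditioning on each event past_event x xbar k h. The
   conditional law P(A(k) = A | past) = p_A(y) is written in product form, which
   is void when the past has probability 0. *)
Record aimd_chain (R : realType) (n : nat) (alpha beta : 'cV[R]_n)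
    (lambda : 'I_n -> R -> R) (x0 xbar0 : 'cV[R]_n)
    (d : measure_display) (T : measurableType d) (P : probability T R)
    (A : nat -> T -> 'M[R]_n) (x xbar : nat -> T -> 'cV[R]_n) : Prop := {
  chain_in : forall k w, aimd_A alpha beta (A k w);
  chain_measurable : forall k M, measurable (A k @^-1` [set M]);
  chain_x0 : forall w, x 0%N w = x0;
  chain_xbar0 : forall w, xbar 0%N w = xbar0;
  chain_x : forall k w, x k.+1 w = A k w *m x k w;
  chain_xbar : forall k w, xbar k.+1 w =
    (k.+2%:R)^-1 *: (A k w *m x k w) + (k.+1%:R / k.+2%:R) *: xbar k w;
  chain_law : forall k (h : nat -> 'cV[R]_n * 'cV[R]_n) (bt : 'cV[R]_n),
    aimd_B beta bt ->
    P (past_event x xbar k h `&` A k @^-1` [set aimd_mx alpha bt]) =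
    ((response_prob lambda beta bt (h k).2)%:E * P (past_event x xbar k h))%E }.

(* Main.v *)
(** The KKT point attracts the averages for the following reason.  Let [D_i] be
    the indicator that agent [i] drops.  Since [alpha_i / (1 - beta_i)] does not
    depend on [i], dividing the [i]-th coordinate of [x(k+1) = A(k) x(k)] by
    [1 - beta_i] shows that [D_i x_i - D_l x_l] is a difference of two
    telescoping bounded terms.  Its conditional mean is
    [lambda_i(xbar_i) x_i - lambda_l(xbar_l) x_l], so a second moment law of
    large numbers along the squares gives almost surely
    [sum_(j < k) (lambda_i(xbar_i(j)) x_i(j) - lambda_l(xbar_l(j)) x_l(j)) = o(k)].

    Fix such a path, let [M_i] be the limsup of [xbar_i], let [i] maximise
    [m = M_i lambda_i(M_i)], let [c] be the common value of [xs_j lambda_j(xs_j)]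
    and suppose [c < m].  At a time [N] with [xbar_i(N)] close to [M_i], look back
    over a window of length [N / L].  The average hardly moves there, so the
    window mean [y] of [x] satisfies [lambda_j(xbar_j(N)) y_j ~ const]; as [y] and
    [xbar(N)] both sum to one, [y_i] lies below [xbar_i(N)] by a fixed amount.
    Hence [xbar_i] exceeded [M_i] at the beginning of the window, which is
    absurd for large [N].  So [m <= c], i.e. [M_j <= xs_j] for all [j], and
    [xbar] converges to [xs] because both sum to one. *)

Require Import Defs.
From mathcomp Require Import measurable_realfun ring lra zify.

Set Implicit Arguments.
Unset Strict Implicit.
Unset Printing Implicit Defensive.

Import Order.TTheory GRing.Theory Num.Theory.
Import numFieldNormedType.Exports.
Local Open Scope classical_set_scope.
Local Open Scope ring_scope.

(** * Uniform continuity, upper limits and an inequality on the simplex *)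

(** Heine's theorem through the near-covering form of compactness. The modulus is quantified by
    [\near 0^'+] so that finitely many functions can share one. *)
Lemma within_continuous_unif (R : realType) (f : R -> R) (a b e : R) :
  {within `[a, b], continuous f} -> 0 < e ->
  \forall t \near 0^'+, forall r s : R, a <= r <= b -> a <= s <= b ->
    `|r - s| < t -> `|f r - f s| < e.
Proof.
move=> cf e0.
pose Q (t r : R) := forall s, a <= r <= b -> a <= s <= b ->
  `|r - s| < t -> `|f r - f s| < e.
suff : \forall t \near 0^'+, `[a, b] `<=` Q t.
  apply: filterS => t H r s hr hs; apply: (H r) => //=.
have /compact_near_coveringP := @segment_compact R a b.
apply => x xab.
have e20 : 0 < e / 2 by lra.
move/subspace_continuousP: cf => /(_ x xab) /cvgrPdist_lt /(_ _ e20).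
rewrite /prop_near1 /within /= => /nbhs_ballP[t /= t0 ht].
(* Halving the radius keeps both [r] and any [s] within [t / 2] of it inside the ball of radius [t]
   around [x]. *)
exists (ball x (t / 2), [set t' | t' < t / 2]) => /=.
  split; first by apply: nbhsx_ballx; lra.
  by apply: nbhs_right_lt; lra.
move=> [r t'] /= [xr tt'] s hr hs rs.
rewrite /ball /= in xr.
have h1 : `|f x - f r| < e / 2.
  by apply: ht => /=; rewrite ?in_itv //= /ball /=; lra.
have h2 : `|f x - f s| < e / 2.
  apply: ht => /=; rewrite ?in_itv //= /ball /=.
  by have := ler_distD r x s; lra.
by have := ler_distD (f x) (f r) (f s); rewrite [`|f r - f x|]distrC; lra.
Qed.

(** [M] is the infimum of the eventual upper bounds; any smaller number fails to be one, hence the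
    recurrence to values above [M - e]. *)
Lemma limsup_real (R : realType) (u : nat -> R) :
  (forall k, 0 <= u k <= 1) -> exists M : R,
  [/\ 0 <= M <= 1,
      forall e : R, 0 < e -> \forall k \near \oo, u k <= M + e &
      forall e : R, 0 < e -> forall K, exists2 k, (K <= k)%N & M - e < u k].
Proof.
move=> u01; pose E := [set c | \forall k \near \oo, u k <= c].
have E1 : E 1 by apply: nearW => k; case/andP: (u01 k).
have lbE : lbound E 0.
  move=> c [K _ /(_ K (leqnn K))] /= h.
  by apply: le_trans h; case/andP: (u01 K).
have hE : has_inf E by split; [exists 1 | exists 0].
exists (inf E); split.
- apply/andP; split; first by apply: lb_le_inf => //; exists 1.
  by apply: ge_inf => //; exists 0.
- move=> e e0; have [c Ec hc] := inf_adherent e0 hE.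
  by apply: filterS Ec => k h; apply: le_trans h (ltW hc).
- move=> e e0 K; apply: contrapT => H.
  have : E (inf E - e).
    exists K => // k /= Kk; rewrite leNgt; apply/negP => h; apply: H; by exists k.
  move=> /(ge_inf (proj2 hE)); lra.
Qed.

(* Both [z] and [y] sum to one and the products [l j * y j] almost agree, so
   [l i0 * y i0] is at most about the inverse of [\sum_j (l j)^-1], whereas the
   existence of [j0] keeps [l i0 * z i0] away from this value. *)
Lemma window_gap (R : realType) (n : nat) (l z y : 'I_n -> R)
    (lmin m c tau : R) (i0 j0 : 'I_n) :
  0 < lmin -> (forall j, lmin <= l j <= 1) ->
  \sum_j z j = 1 -> \sum_j y j = 1 ->
  (forall j, l j * z j <= m + tau) -> l j0 * z j0 <= c ->
  m - tau <= l i0 * z i0 ->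
  (forall j, `|l j * y j - l i0 * y i0| <= tau) ->
  0 < tau -> c < m -> (m - c) * lmin = 8 * n%:R * tau ->
  y i0 <= z i0 - 5 * tau.
Proof.
move=> l0 hl sz sy hz hz0 hi hy tau0 cm htau.
pose S := \sum_j (l j)^-1.
have lp j : 0 < l j by case/andP: (hl j) => h _; apply: lt_le_trans h.
have lV j : 1 <= (l j)^-1 by rewrite invf_ge1 //; case/andP: (hl j).
have n0 : 0 < n%:R :> R by rewrite ltr0n (leq_ltn_trans _ (ltn_ord i0)).
have S0 : 0 < S.
  rewrite /S (bigD1 i0) //= ltr_wpDr ?invr_gt0 //.
  by apply: sumr_ge0 => j _; rewrite invr_ge0 ltW.
have SE : S * lmin <= n%:R.
  rewrite /S mulr_suml (le_trans (y := \sum_(j < n) 1)) //; last first.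
    by rewrite sumr_const card_ord.
  apply: ler_sum => j _; rewrite mulrC ler_pdivrMr // mul1r.
  by case/andP: (hl j).
(* Sum over [j] of [y j >= (l i0 * y i0 - tau) / l j]. *)
have h1 : (l i0 * y i0 - tau) * S <= 1.
  rewrite -sy /S mulr_sumr; apply: ler_sum => j _.
  rewrite ler_pdivrMr // [y j * _]mulrC.
  have := hy j; rewrite ler_norml => /andP[]; lra.
(* Here [z j <= (m + tau) / l j], and the term [j0] saves [(m + tau - c) / l j0], at least [m - c]
   because [l j0 <= 1]. *)
have h2 : 1 <= (m + tau) * S - (m - c).
  have SD : S = (l j0)^-1 + \sum_(i | i != j0) (l i)^-1 by rewrite /S (bigD1 j0).
  move: sz; rewrite (bigD1 j0) //= => sz.
  have a1 : \sum_(i | i != j0) z i <= (m + tau) * \sum_(i | i != j0) (l i)^-1.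
    rewrite mulr_sumr; apply: ler_sum => j _.
    by rewrite ler_pdivlMr // mulrC.
  have a2 : z j0 <= c / l j0 by rewrite ler_pdivlMr // mulrC.
  have a3 : m + tau - c <= (m + tau - c) / l j0.
    by rewrite ler_peMr //; lra.
  have a4 : (m + tau) / l j0 = c / l j0 + (m + tau - c) / l j0.
    by field; rewrite gt_eqF.
  have : (m + tau) * S = (m + tau) / l j0 + (m + tau) * \sum_(i | i != j0) (l i)^-1.
    by rewrite SD mulrDr.
  lra.
(* Since [S * lmin <= n], the saving [m - c] is at least [8 * tau * S]. Of these [8 * tau], two are
   lost between [h1] and [h2] and one in [hi], which leaves five. *)
have h3 : (m + 2 * tau - 8 * tau - l i0 * y i0) * S >= 0.
  have : 8 * tau * S <= m - c.
    rewrite -(ler_pM2r l0) htau.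
    have : tau * (S * lmin) <= tau * n%:R by rewrite ler_pM2l.
    lra.
  lra.
have h4 : 0 <= m + 2 * tau - 8 * tau - l i0 * y i0.
  by rewrite -(pmulr_lge0 _ S0).
have h5 : 5 * tau <= l i0 * (z i0 - y i0) by lra.
have zy : 0 <= z i0 - y i0.
  by rewrite -(pmulr_rge0 _ (lp i0)); lra.
have h6 : l i0 * (z i0 - y i0) <= z i0 - y i0.
  by rewrite ler_piMl //; case/andP: (hl i0).
lra.
Qed.

(** * Deterministic paths and their running averages *)

(** The recurrence is cleared of denominators, and [xb 0] is not tied to [x 0], as the initial
    average is arbitrary. *)
Record averaged_path (R : realType) (n : nat) (x xb : nat -> 'I_n -> R) : Prop := {
  path_ge0 : forall k j, 0 <= x k j;
  path_sum : forall k, \sum_j x k j = 1;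
  avg_ge0 : forall k j, 0 <= xb k j;
  avg_sum : forall k, \sum_j xb k j = 1;
  avg_rec : forall k j, k.+2%:R * xb k.+1 j = x k.+1 j + k.+1%:R * xb k j }.

Lemma sum1_itv01 (R : realType) (n : nat) (f : 'I_n -> R) j :
  (forall i, 0 <= f i) -> \sum_i f i = 1 -> 0 <= f j <= 1.
Proof.
move=> f0 <-; rewrite f0 (bigD1 j) //= lerDl; exact: sumr_ge0.
Qed.

Section averaged.
Context (R : realType) (n : nat) (x xb : nat -> 'I_n -> R).
Context (hp : averaged_path x xb).

Lemma path_itv k j : 0 <= x k j <= 1.
Proof. exact: sum1_itv01 (path_ge0 hp k) (path_sum hp k). Qed.

Lemma avg_itv k j : 0 <= xb k j <= 1.
Proof. exact: sum1_itv01 (avg_ge0 hp k) (avg_sum hp k). Qed.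

(** The average collects the states [a + 1] to [a + d], whereas cumulated responses run over [a] to
    [a + d - 1]; the last bracket corrects this shift. *)
Lemma avg_telescope a d j :
  (a + d).+1%:R * xb (a + d)%N j =
  a.+1%:R * xb a j + \sum_(i < d) x (a + i)%N j + (x (a + d)%N j - x a j).
Proof.
elim: d => [|d IH]; first by rewrite addn0 big_ord0 addr0 subrr addr0.
rewrite addnS (avg_rec hp) IH big_ord_recr /=; lra.
Qed.

(** Each step changes the average by [(x - xb) / (k + 2)], with both entries in the unit
    interval. *)
Lemma avg_drift a d j : `|xb (a + d)%N j - xb a j| <= d%:R / a.+1%:R.
Proof.
elim: d => [|d IH]; first by rewrite addn0 subrr normr0 mul0r.
have a0 : 0 < a.+1%:R :> R by rewrite ltr0n.
have h : `|xb (a + d).+1 j - xb (a + d)%N j| <= a.+1%:R^-1.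
  have /andP[x0 x1] := path_itv (a + d).+1 j.
  have /andP[y0 y1] := avg_itv (a + d) j.
  have k0 : 0 < (a + d).+2%:R :> R by rewrite ltr0n.
  have -> : xb (a + d).+1 j - xb (a + d)%N j =
      (x (a + d).+1 j - xb (a + d)%N j) / (a + d).+2%:R.
    apply: (mulfI (lt0r_neq0 k0)); rewrite mulrBr (avg_rec hp).
    rewrite mulrCA divff ?lt0r_neq0 //.
    by rewrite -[(a + d).+2]addn1 natrD; ring.
  rewrite normrM normfV (gtr0_norm k0) ler_pdivrMr //.
  have : (1 : R) <= a.+1%:R^-1 * (a + d).+2%:R.
    by rewrite mulrC ler_pdivlMr // mul1r ler_nat; lia.
  by apply: le_trans; rewrite ler_norml; lra.
rewrite addnS; apply: le_trans (ler_distD (xb (a + d)%N j) _ _) _.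
rewrite -[d.+1]addn1 natrD mulrDl div1r addrC; exact: lerD.
Qed.

End averaged.

(** * Monotonicity and stability of the responses *)

Section response.
Context (R : realType) (n : nat) (lambda : 'I_n -> R -> R).
Context (hl : response_assumptions lambda).

Lemma response_homo i r s : 0 <= r -> r <= s -> s <= 1 ->
  r * lambda i r <= s * lambda i s.
Proof.
move=> r0; rewrite le_eqVlt => /orP[/eqP -> //|rs] s1.
by apply/ltW/(lambda_increasing hl).
Qed.

Lemma response_mono i r s : 0 <= r <= 1 -> 0 <= s <= 1 ->
  r * lambda i r <= s * lambda i s -> r <= s.
Proof.
move=> /andP[r0 r1] /andP[s0 s1] h; rewrite leNgt; apply/negP => sr.
by have := lambda_increasing hl i s0 sr r1; rewrite ltNge h.
Qed.

(** When [s < r], the difference splits as [r * (lambda i r - lambda i s) + (r - s) * lambda i s],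
    and each part is at most [e]. *)
Lemma response_le i (r s t e : R) : 0 <= r <= 1 -> 0 <= s <= 1 -> r <= s + t ->
  0 <= t < e -> (forall r s : R, 0 <= r <= 1 -> 0 <= s <= 1 -> `|r - s| <= t ->
     `|lambda i r - lambda i s| <= e) ->
  r * lambda i r <= s * lambda i s + 2 * e.
Proof.
move=> r01 s01 rst /andP[t0 te] hu.
have /andP[r0 r1] := r01; have /andP[s0 s1] := s01.
have [rs|sr] := leP r s.
  have := response_homo i r0 rs s1.
  lra.
have h : `|r - s| <= t by rewrite ger0_norm; lra.
have := hu _ _ r01 s01 h; rewrite ler_norml => /andP[_ h1].
have /andP[l0 l1] := lambda_itv hl i s01.
have : r * (lambda i r - lambda i s) <= r * e by rewrite ler_wpM2l //; lra.
have : (r - s) * lambda i s <= (r - s) by rewrite ler_piMr //; lra.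
have : r * e <= e by rewrite ler_piMl //; lra.
lra.
Qed.
End response.

(** * Backward windows and convergence of a single path *)

(** The compensator of the accumulated terms [D_j x_j], where [D_j] indicates a drop of agent
    [j]. *)
Definition cumulated_response (R : realType) (n : nat) (lambda : 'I_n -> R -> R)
    (x xb : nat -> 'I_n -> R) (k : nat) (j : 'I_n) : R :=
  \sum_(i < k) lambda j (xb i j) * x i j.

Section averaged_response.
Context (R : realType) (n : nat) (lambda : 'I_n -> R -> R).
Context (hl : response_assumptions lambda).
Context (x xb : nat -> 'I_n -> R).
Context (hp : averaged_path x xb).

Let Lam := cumulated_response lambda x xb.

(** The response is frozen at its value at the end of the window. The factor 2 in the drift comes
    from comparing both averages with the one at time [a]. *)
Lemma response_window a d j (t e : R) :
  (forall r s : R, 0 <= r <= 1 -> 0 <= s <= 1 -> `|r - s| <= t ->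
     `|lambda j r - lambda j s| <= e) ->
  2 * (d%:R / a.+1%:R) <= t ->
  `|Lam (a + d)%N j - Lam a j
    - lambda j (xb (a + d)%N j) * \sum_(i < d) x (a + i)%N j| <= e * d%:R.
Proof.
move=> hu ht.
have -> : Lam (a + d)%N j - Lam a j =
    \sum_(i < d) lambda j (xb (a + i)%N j) * x (a + i)%N j.
  rewrite /Lam /cumulated_response big_split_ord /= addrAC subrr add0r.
  by apply: eq_bigr.
rewrite mulr_sumr -sumrB (le_trans (ler_norm_sum _ _ _)) //.
rewrite (le_trans (y := \sum_(i < d) e)) //; last first.
  by rewrite sumr_const card_ord mulr_natr.
apply: ler_sum => i _; rewrite -mulrBl normrM.
have /andP[x0 x1] := path_itv hp (a + i)%N j.
have : `|lambda j (xb (a + i)%N j) - lambda j (xb (a + d)%N j)| <= e.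
  apply: hu; try exact: avg_itv hp _ _.
  apply: le_trans ht.
  have h1 := avg_drift hp a i j; have h2 := avg_drift hp a d j.
  have : i%:R / a.+1%:R <= d%:R / a.+1%:R :> R.
    by rewrite ler_pM2r ?invr_gt0 ?ltr0n // ler_nat ltnW.
  have := ler_distD (xb a j) (xb (a + i)%N j) (xb (a + d)%N j).
  rewrite [`|xb a j - _|]distrC; move: h1 h2.
  by move: (i%:R / _) (d%:R / _) => p q *; lra.
move=> h; apply: le_trans h.
by rewrite (ger0_norm x0) ler_piMr.
Qed.

(** [window_gap] applied to the window mean forces the average to have been larger at time [a]. The
    lost [1] bounds the boundary term of [avg_telescope]. *)
Lemma backward_step a d i0 j0 (t kap lmin m c tau : R) :
  (0 < d)%N -> 0 < lmin ->
  (forall j r, 0 <= r <= 1 -> lmin <= lambda j r) ->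
  (forall j (r s : R), 0 <= r <= 1 -> 0 <= s <= 1 -> `|r - s| <= t ->
     `|lambda j r - lambda j s| <= tau / 4) ->
  2 * (d%:R / a.+1%:R) <= t ->
  (forall j, `|Lam a j - Lam a i0| <= kap) ->
  (forall j, `|Lam (a + d)%N j - Lam (a + d)%N i0| <= kap) ->
  kap <= tau / 4 * d%:R ->
  (forall j, xb (a + d)%N j * lambda j (xb (a + d)%N j) <= m + tau) ->
  xb (a + d)%N j0 * lambda j0 (xb (a + d)%N j0) <= c ->
  m - tau <= xb (a + d)%N i0 * lambda i0 (xb (a + d)%N i0) ->
  0 < tau -> c < m -> (m - c) * lmin = 8 * n%:R * tau ->
  xb (a + d)%N i0 + (5 * tau * d%:R - 1) / a.+1%:R <= xb a i0.
Proof.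
move=> d0 l0 hlmin hu ht ka kad hk hz hz0 hi tau0 cm htau.
have dR : 0 < d%:R :> R by rewrite ltr0n.
have aR : 0 < a.+1%:R :> R by rewrite ltr0n.
pose X j := \sum_(i < d) x (a + i)%N j.
pose l j := lambda j (xb (a + d)%N j).
have hX : \sum_j X j / d%:R = 1.
  rewrite -mulr_suml exchange_big /=.
  under eq_bigr do rewrite (path_sum hp).
  by rewrite sumr_const card_ord divff ?lt0r_neq0.
have gap : X i0 / d%:R <= xb (a + d)%N i0 - 5 * tau.
  apply: (@window_gap R n l (xb (a + d)%N) (fun j => X j / d%:R)
    lmin m c tau i0 j0) => //.
  - move=> j; have b := avg_itv hp (a + d) j.
    by rewrite /l hlmin //=; case/andP: (lambda_itv hl j b).
  - exact: avg_sum hp _.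
  - by move=> j; rewrite mulrC.
  - by rewrite mulrC.
  - by rewrite mulrC.
  (* Four errors of size [tau / 4 * d] add up to [tau * d]: the two differences of [Lam] at the ends
     of the window and the freezing errors for [j] and [i0]. *)
  - move=> j; rewrite !mulrA -mulrBl normrM normfV (gtr0_norm dR) ler_pdivrMr //.
    have := response_window (hu j) ht; have := response_window (hu i0) ht.
    rewrite -/(l j) -/(X j) -/(l i0) -/(X i0).
    have := ka j; have := kad j.
    rewrite !ler_norml => /andP[? ?] /andP[? ?] /andP[? ?] /andP[? ?].
    by apply/andP; split; lra.
move: gap; rewrite ler_pdivrMr // => gap.
have := avg_telescope hp a d i0; rewrite -/(X i0) => tel.
have /andP[u0 u1] := path_itv hp (a + d)%N i0.
have /andP[v0 v1] := path_itv hp a i0.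
rewrite -(ler_pM2l aR) mulrDr [a.+1%:R * (_ / _)]mulrC divfK ?lt0r_neq0 //.
have e1 : (a + d).+1%:R = a.+1%:R + d%:R :> R by rewrite -natrD addSn.
rewrite e1 in tel; lra.
Qed.

Lemma averaged_cvg (xs : 'I_n -> R) (c : R) :
  (forall j, 0 <= xs j) -> \sum_j xs j = 1 ->
  (forall j, xs j * lambda j (xs j) = c) ->
  (forall i j (e : R), 0 < e ->
     \forall k \near \oo, `|Lam k i - Lam k j| <= e * k%:R) ->
  forall i (e : R), 0 < e -> \forall k \near \oo, `|xb k i - xs i| < e.
Proof.
move=> xs0 sxs hc hLam i e e0.
have xsi j : 0 <= xs j <= 1 by apply: sum1_itv01.
have nR : 0 < n%:R :> R by rewrite ltr0n (leq_ltn_trans _ (ltn_ord i)).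
have /choice[M hM] : forall j, exists M : R, [/\ 0 <= M <= 1,
      forall e : R, 0 < e -> \forall k \near \oo, xb k j <= M + e &
      forall e : R, 0 < e -> forall K, exists2 k, (K <= k)%N & M - e < xb k j].
  by move=> j; apply: limsup_real => k; exact: avg_itv hp _ _.
have M01 j : 0 <= M j <= 1 by case: (hM j).
pose g j := M j * lambda j (M j).
(* By strict monotonicity [g j <= c] gives [M j <= xs j]; since both vectors sum to one, upper
   bounds on the other coordinates give the lower bound for [i]. *)
suff gc j : g j <= c.
  have Mxs j : M j <= xs j.
    by apply: (response_mono hl (i := j)) => //; rewrite hc; exact: gc.
  pose e' := e / (2 * n%:R).
  have e'0 : 0 < e' by rewrite divr_gt0 // mulr_gt0.
  have : \forall k \near \oo, forall j, xb k j <= xs j + e'.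
    apply: filter_forall => j; case: (hM j) => _ /(_ _ e'0) + _.
    by apply: filterS => k; have := Mxs j; lra.
  apply: filterS => k hk.
  have ne : n%:R * e' = e / 2 by rewrite /e'; field; rewrite lt0r_neq0.
  have e'e : e' <= e / 2.
    rewrite -ne ler_peMl //; first exact: ltW.
    by rewrite ler1n (leq_ltn_trans _ (ltn_ord i)).
  have : \sum_(j | j != i) xb k j <= \sum_(j | j != i) xs j + n%:R * e'.
    rewrite (le_trans (y := \sum_(j | j != i) (xs j + e'))) //.
      by apply: ler_sum => j _.
    rewrite big_split /= lerD2l sumr_const -[leLHS]mulr_natl ler_wpM2r //; first
      exact: ltW.
    by rewrite ler_nat; apply: leq_trans (max_card _) _; rewrite card_ord.
  have := avg_sum hp k; rewrite (bigD1 i) //=.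
  move: sxs; rewrite (bigD1 i) //=.
  have := hk i; rewrite ltr_norml; move=> *; apply/andP; split; lra.
pose i0 := [arg max_(j > i) g j]%O.
have gi0 : forall j, g j <= g i0.
  by rewrite /i0; case: Order.TotalTheory.arg_maxP => // i1 _ h k; exact: h.
apply: le_trans (gi0 j) _; clear j.
rewrite leNgt; apply/negP => cm.
set m := g i0 in cm gi0.
have [lmin l0 hlmin] := lambda_bounded_below hl.
pose tau := (m - c) * lmin / (8 * n%:R).
have tau0 : 0 < tau by rewrite divr_gt0 ?mulr_gt0 ?subr_gt0.
have htau : (m - c) * lmin = 8 * n%:R * tau.
  by rewrite /tau; field; rewrite lt0r_neq0.
have tau40 : 0 < tau / 4 by lra.
have [t t0 hu] : exists2 t : R, 0 < t &
    forall j (r s : R), 0 <= r <= 1 -> 0 <= s <= 1 ->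
    `|r - s| <= t -> `|lambda j r - lambda j s| <= tau / 4.
  have : \forall t \near 0^'+, forall j (r s : R), 0 <= r <= 1 -> 0 <= s <= 1 ->
      `|r - s| < t -> `|lambda j r - lambda j s| < tau / 4.
    apply: filter_forall => j.
    exact: within_continuous_unif (@lambda_continuous _ _ _ hl j) tau40.
  move=> h; have : \forall t \near 0^'+, 0 < t /\
      (forall j (r s : R), 0 <= r <= 1 -> 0 <= s <= 1 ->
      `|r - s| < t -> `|lambda j r - lambda j s| < tau / 4).
    by apply: filterS2 h (nbhs_right_gt 0) => t' ? ?.
  move=> /filter_ex[t' [t'0 ht']]; exists (t' / 2); first lra.
  by move=> j r s r01 s01 rs; apply/ltW/ht' => //; lra.
(* Windows have length about [N / L]: [L >= 2] keeps their beginning beyond [N / 2], and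
   [4 / L <= t] keeps the drift within the modulus of continuity. *)
pose L := maxn 2 (Num.bound (4 / t)).
have L2 : (2 <= L)%N by rewrite leq_maxl.
have LR : 0 < L%:R :> R by rewrite ltr0n (leq_trans _ L2).
have Lt : 4 / L%:R <= t.
  rewrite ler_pdivrMr // mulrC -ler_pdivrMr //.
  apply: le_trans (ltW (archi_boundP (ltW (divr_gt0 _ t0)))) _ => //.
  by rewrite ler_nat leq_maxr.
clearbody L.
(* [eta] is the accuracy of the upper limits; [2 * L * eta <= tau] makes it small against the gain
   over one window, which is of order [tau / L]. *)
pose eta := Num.min t (tau / (2 * L%:R)).
have eta0 : 0 < eta by rewrite lt_min t0 divr_gt0 // mulr_gt0.
have etat : eta <= t by rewrite ge_min lexx.
have etaL : eta * (2 * L%:R) <= tau.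
  by rewrite -ler_pdivlMr ?mulr_gt0 // ge_min lexx orbT.
have etatau : eta < tau / 2.
  have : eta * 2 <= eta * L%:R by rewrite ler_pM2l // ler_nat.
  lra.
have tL0 : 0 < tau / (8 * L%:R) by rewrite divr_gt0 // mulr_gt0.
have : \forall k \near \oo, forall j, xb k j <= M j + eta /\
    `|Lam k j - Lam k i0| <= tau / (8 * L%:R) * k%:R.
  apply: filter_forall => k; case: (hM k) => _ /(_ _ eta0) h1 _.
  by apply: filterS2 h1 (hLam k i0 _ tL0) => ? ? ?.
case=> K _ hK.
(* For [N >= B] the window satisfies [tau * d > 2], which outweighs the boundary loss [1]. *)
pose B := Num.bound (4 * L%:R / tau).
have hB : 4 * L%:R < B%:R * tau.
  by rewrite -ltr_pdivrMr //; apply: archi_boundP; rewrite ltW // divr_gt0 // mulr_gt0.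
clearbody B.
(* The lower bound on [N] ensures [K <= a], a nonempty window and [B <= N]. *)
have [_ _ /(_ _ eta0 (2 * K + 2 * L + B)%N)[N NK hN]] := hM i0.
have LN : (L <= N)%N by move: NK; clear; lia.
pose d := (N %/ L)%N.
have dN : (d * L <= N)%N by rewrite leq_trunc_div.
have Nd : (N < d.+1 * L)%N by rewrite ltn_ceil // (leq_trans _ L2).
have d0 : (0 < d)%N by rewrite divn_gt0 ?(leq_trans _ L2).
clearbody d.
have d2 : (d * 2 <= N)%N by apply: leq_trans dN; rewrite leq_mul2l L2 orbT.
pose a := (N - d)%N.
have ad : (a + d)%N = N by rewrite /a subnK //; move: d2; clear; lia.
have aR : 0 < a.+1%:R :> R by rewrite ltr0n.
have Ka : (K <= a)%N by rewrite /a; move: d2 NK; clear; lia.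
have KN : (K <= N)%N by move: NK; clear; lia.
have dNR : d%:R * L%:R <= N%:R :> R by rewrite -natrM ler_nat.
have NdR : N%:R <= d%:R * L%:R * 2 :> R.
  rewrite -!natrM ler_nat; apply: leq_trans (ltnW Nd) _.
  by rewrite mulSn -mulnA muln2; move: d0; clear; nia.
have aNR : a.+1%:R <= N%:R :> R by rewrite ler_nat /a; move: d0 d2; clear; lia.
have NaR : N%:R <= 2 * a.+1%:R :> R by rewrite -natrM ler_nat /a; move: d2; clear; lia.
have BN : B%:R <= N%:R :> R by rewrite ler_nat; move: NK; clear; lia.
have [j0 hj0] : exists j0, xb N j0 <= xs j0.
  apply: contrapT => /forallNP h.
  have : \sum_j xs j < \sum_j xb N j.
    apply: ltr_sum => [|j' _]; first by apply/hasP; exists i => //; rewrite mem_index_enum.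
    by rewrite ltNge; apply/negP; exact: h.
  by rewrite sxs (avg_sum hp) ltxx.
have hue j' r s : 0 <= r <= 1 -> 0 <= s <= 1 -> `|r - s| <= eta ->
     `|lambda j' r - lambda j' s| <= tau / 2.
  move=> r01 s01 rs; apply: le_trans (hu _ _ _ r01 s01 (le_trans rs etat)) _; lra.
have etab : 0 <= eta < tau / 2 by rewrite ltW.
have tau2 : 2 * (tau / 2) = tau by field.
have := @backward_step a d i0 j0 t (tau / (8 * L%:R) * N%:R) lmin m c tau
  d0 l0 hlmin hu.
have ht : 2 * (d%:R / a.+1%:R) <= t.
  apply: le_trans Lt; rewrite mulrA ler_pdivrMr // mulrAC ler_pdivlMr //; lra.
move=> /(_ ht); rewrite ad.
have hka j' : `|Lam a j' - Lam a i0| <= tau / (8 * L%:R) * N%:R.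
  have [_] := hK a Ka j'; move/le_trans; apply.
  by rewrite ler_pM2l // ler_nat /a leq_subr.
have hkN j' : `|Lam N j' - Lam N i0| <= tau / (8 * L%:R) * N%:R.
  by have [_] := hK N KN j'.
have hkap : tau / (8 * L%:R) * N%:R <= tau / 4 * d%:R.
  rewrite mulrAC ler_pdivrMr ?mulr_gt0 //.
  have : tau * N%:R <= tau * (d%:R * L%:R * 2) by rewrite ler_pM2l.
  lra.
move=> /(_ hka hkN hkap) step.
have hz j' : xb N j' * lambda j' (xb N j') <= m + tau.
  have [h1 _] := hK N KN j'.
  have := response_le hl (avg_itv hp N j') (M01 j') h1 etab (hue j').
  by rewrite tau2; move/le_trans; apply; rewrite lerD2r; exact: gi0.
have hz0 : xb N j0 * lambda j0 (xb N j0) <= c.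
  rewrite -(hc j0); apply: (response_homo hl) => //; first exact: avg_ge0 hp _ _.
  by case/andP: (xsi j0).
have hi : m - tau <= xb N i0 * lambda i0 (xb N i0).
  have h1 : M i0 <= xb N i0 + eta by lra.
  have := response_le hl (M01 i0) (avg_itv hp N i0) h1 etab (hue i0).
  rewrite -/(g i0) -/m; lra.
have h2 := step hz hz0 hi tau0 cm htau.
have [h1 _] := hK a Ka i0.
(* The average is above [M i0 - eta] at [N] and at most [M i0 + eta] at [a], so the gain is below
   [2 * eta]. This yields [5 * tau * d - 1 < 2 * tau * d], against [tau * d > 2]. *)
have h3 : (5 * tau * d%:R - 1) / a.+1%:R < 2 * eta.
  by move: h1 h2 hN; move: (_ / _) => q *; lra.
move: h3; rewrite ltr_pdivrMr // => h3.
have h4 : eta * a.+1%:R <= eta * (d%:R * L%:R * 2) by rewrite ler_pM2l //; lra.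
have h5 : eta * (2 * L%:R) * d%:R <= tau * d%:R by rewrite ler_pM2r // ltr0n.
have h6 : 4 * L%:R < tau * (d%:R * L%:R * 2).
  apply: lt_le_trans hB _; rewrite mulrC ler_pM2l //; lra.
have h7 : 4 < tau * d%:R * 2.
  by rewrite -(ltr_pM2r LR); lra.
lra.
Qed.
End averaged_response.

(** * A law of large numbers along the squares *)

Lemma nat_sqrt (N : nat) : exists q : nat, (q ^ 2 <= N < q.+1 ^ 2)%N.
Proof.
elim: N => [|N [q /andP[h1 h2]]]; first by exists 0%N.
have [h|h] := leqP (q.+1 ^ 2)%N N.+1; last by exists q; rewrite h leqW.
by exists q.+1; rewrite h /=; apply: leq_ltn_trans h2 _; rewrite ltn_exp2r.
Qed.

(** From [q ^ 2] to any [N < q.+1 ^ 2] there are at most [2 * q] steps, so [s] changes by at most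
    [2 * C * q], negligible against [q ^ 2]. *)
Lemma little_o_of_squares (R : realType) (s : nat -> R) (C : R) :
  (forall k, `|s k.+1 - s k| <= C) ->
  (forall e : R, 0 < e -> \forall k \near \oo, `|s (k ^ 2)%N| <= e * (k ^ 2)%:R) ->
  forall e : R, 0 < e -> \forall k \near \oo, `|s k| <= e * k%:R.
Proof.
move=> hC hs e e0.
have lip a d : `|s (a + d)%N - s a| <= C * d%:R.
  elim: d => [|d IH]; first by rewrite addn0 subrr normr0 mulr0.
  rewrite addnS; apply: le_trans (ler_distD (s (a + d)%N) _ _) _.
  by rewrite -[d.+1]addn1 natrD mulrDr mulr1 addrC; apply: lerD.
have C0 : 0 <= C by apply: le_trans (hC 0%N).
have e20 : 0 < e / 2 by lra.
have [K _ hK] := hs _ e20.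
pose B := Num.bound (4 * C / e).
have hB : 4 * C < B%:R * e.
  by rewrite -ltr_pdivrMr //; apply: archi_boundP; rewrite divr_ge0 ?mulr_ge0 // ltW.
exists ((K + B) ^ 2)%N => // N /= hN.
have [q /andP[qN Nq]] := nat_sqrt N.
have Kq : (K + B <= q)%N.
  by rewrite -ltnS -(ltn_exp2r _ _ (isT : (0 < 2)%N)); apply: leq_ltn_trans Nq.
have h1 := hK q (leq_trans (leq_addr _ _) Kq).
have Bq : B%:R <= q%:R :> R by rewrite ler_nat; apply: leq_trans (leq_addl _ _) Kq.
have h2 := lip (q ^ 2)%N (N - q ^ 2)%N.
rewrite subnKC // in h2.
have h3 : (N - q ^ 2)%:R <= 2 * q%:R :> R.
  rewrite -natrM ler_nat leq_subLR; move: Nq; clear.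
  by rewrite -[q.+1]addn1 sqrnD muln1; lia.
have h4 : C * (N - q ^ 2)%:R <= C * (2 * q%:R) by rewrite ler_wpM2l.
have h5 : 4 * C * q%:R <= B%:R * e * q%:R by rewrite ler_wpM2r // ltW.
have h6 : e * q%:R * B%:R <= e * q%:R * q%:R by rewrite ler_wpM2l // mulr_ge0 // ltW.
have h7 : e * (q ^ 2)%:R <= e * N%:R by rewrite ler_pM2l // ler_nat.
have h8 : (q ^ 2)%:R = q%:R * q%:R :> R by rewrite -natrM mulnn.
have h9 := ler_distD (s (q ^ 2)%N) (s N) 0.
rewrite !subr0 in h9.
rewrite h8 in h1 h7; lra.
Qed.

Lemma sum_inv_squares_le (R : realType) (N : nat) :
  \sum_(k < N) (k.+1%:R ^+ 2)^-1 <= 2 :> R.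
Proof.
case: N => [|N]; first by rewrite big_ord0.
(* The bound is sharpened for the induction, by comparison with the telescoping
   [u^-1 - (u + 1)^-1]. *)
suff : \sum_(k < N.+1) (k.+1%:R ^+ 2)^-1 <= 2 - N.+1%:R^-1 :> R.
  by move=> /le_trans; apply; rewrite gerBl invr_ge0.
elim: N => [|N IH]; first by rewrite big_ord1 expr1n invr1; lra.
rewrite big_ord_recr /=.
have a0 : 0 < N.+1%:R :> R by rewrite ltr0n.
have a1 : N.+2%:R = N.+1%:R + 1 :> R by rewrite -[N.+2]addn1 natrD.
move: IH; rewrite a1; move: (N.+1%:R) a0 (\sum_(i < N.+1) _) => u u0 s IH.
have : u^-1 - (u + 1)^-1 - ((u + 1) ^+ 2)^-1 = (u * (u + 1) ^+ 2)^-1.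
  by field; apply/andP; split; apply: lt0r_neq0; lra.
have : 0 <= (u * (u + 1) ^+ 2)^-1 by rewrite invr_ge0 mulr_ge0 ?sqr_ge0 //; lra.
move: IH; move: (u^-1) ((u + 1)^-1) (((u + 1) ^+ 2)^-1) => *; lra.
Qed.

Section lln.
Context (d : measure_display) (T : measurableType d) (R : realType).
Context (P : probability T R).

Lemma bounded_integrable (f : T -> R) (C : R) :
  measurable_fun setT f -> (forall w, `|f w| <= C) ->
  P.-integrable setT (EFin \o f).
Proof.
move=> mf hf; apply: measurable_bounded_integrable => //.
  by apply: le_lt_trans (probability_le1 P measurableT) _; rewrite ltry.
exists C; split; first exact: num_real.
by move=> M CM w _; apply: le_trans (hf w) (ltW CM).
Qed.

(** Orthogonality to the preceding partial sum removes the cross term, so each step adds at most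
    [C ^+ 2]. *)
Lemma second_moment_le (xi : nat -> T -> R) (C : R) :
  (forall k, measurable_fun setT (xi k)) ->
  (forall k w, `|xi k w| <= C) ->
  (forall k, \int[P]_w ((\sum_(i < k) xi i w) * xi k w) = 0) ->
  forall k, \int[P]_w ((\sum_(i < k) xi i w) ^+ 2) <= C ^+ 2 * k%:R.
Proof.
move=> mxi hC ho; elim=> [|k IH].
  by under eq_Rintegral do rewrite big_ord0 expr0n /=; rewrite Rintegral_cst // mul0r mulr0.
pose S w := \sum_(i < k) xi i w.
have mS : measurable_fun setT S by apply: measurable_sum.
have C0 : 0 <= C by apply: le_trans (hC 0%N point).
have hS w : `|S w| <= C * k%:R.
  apply: le_trans (ler_norm_sum _ _ _) _.
  rewrite (le_trans (y := \sum_(i < k) C)) ?ler_sum // sumr_const card_ord.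
  by rewrite mulr_natr.
have i1 : P.-integrable setT (EFin \o (fun w => S w ^+ 2)).
  apply: (@bounded_integrable _ ((C * k%:R) ^+ 2)); first exact: measurable_funX.
  by move=> w; rewrite normrX lerXn2r ?nnegrE // mulr_ge0.
have i2 : P.-integrable setT (EFin \o (fun w => S w * xi k w)).
  apply: (@bounded_integrable _ (C * k%:R * C)); first exact: measurable_funM.
  by move=> w; rewrite normrM ler_pM.
have i3 : P.-integrable setT (EFin \o (fun w => xi k w ^+ 2)).
  apply: (@bounded_integrable _ (C ^+ 2)); first exact: measurable_funX.
  by move=> w; rewrite normrX lerXn2r ?nnegrE.
have i22 : P.-integrable setT (EFin \o (fun w => 2 * (S w * xi k w))).
  apply: (@bounded_integrable _ (2 * (C * k%:R * C))).
    by apply: measurable_funM => //; exact: measurable_funM.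
  by move=> w; rewrite normrM ger0_norm // ler_pM2l // normrM ler_pM.
have i122 : P.-integrable setT (EFin \o (fun w => S w ^+ 2 + 2 * (S w * xi k w))).
  exact: integrableD i1 i22.
under eq_Rintegral => w _.
  rewrite big_ord_recr /= -/(S w).
  have -> : (S w + xi k w) ^+ 2 = S w ^+ 2 + 2 * (S w * xi k w) + xi k w ^+ 2 by ring.
  over.
rewrite RintegralD // RintegralD // RintegralZl // ho mulr0 addr0.
rewrite -[k.+1]addn1 natrD mulrDr mulr1 lerD //.
have -> : C ^+ 2 = \int[P]_w (C ^+ 2).
  by rewrite Rintegral_cst // [X in fine X](_ : _ = 1%E) ?mulr1 //; exact: probability_setT.
apply: le_Rintegral => //.
  by apply: (@bounded_integrable _ `|C ^+ 2|).
by move=> w _ /=; rewrite -[leLHS]ger0_norm ?sqr_ge0 // normrX lerXn2r ?nnegrE.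
Qed.

(** By monotone convergence the series of the [f k] has a finite integral; it is then finite almost
    everywhere and its terms vanish in the limit. *)
Lemma ae_cvg0_of_summable_moments (f : nat -> T -> R) (B : R) :
  (forall k, measurable_fun setT (f k)) -> (forall k w, 0 <= f k w) ->
  (forall k, P.-integrable setT (EFin \o f k)) ->
  (forall N, \sum_(k < N) \int[P]_w f k w <= B) ->
  {ae P, forall w, f k w @[k --> \oo] --> 0}.
Proof.
move=> mf f0 intf hB.
pose F w := (\sum_(k <oo) (f k w)%:E)%E.
have mF : measurable_fun setT F.
  apply: ge0_emeasurable_sum => [k w _ _|k _]; first by rewrite lee_fin.
  exact/measurable_EFinP.
have F0 w : (0 <= F w)%E by apply: nneseries_ge0 => k _ _; rewrite lee_fin.
have intF : (\int[P]_w F w <= B%:E)%E.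
  rewrite integral_nneseries //; last first.
  - by move=> k w _; rewrite lee_fin.
  - by move=> k; exact/measurable_EFinP.
  apply: lime_le.
    by apply: is_cvg_nneseries => k _ _; apply: integral_ge0 => w _; rewrite lee_fin.
  apply: nearW => N /=.
  have -> : (\sum_(0 <= k < N) \int[P]_x (f k x)%:E =
      (\sum_(k < N) \int[P]_w f k w)%:E)%E.
    rewrite big_mkord -sumEFin; apply: eq_bigr => k _.
    rewrite /Rintegral fineK //. exact: integrable_fin_num (intf k).
  by rewrite lee_fin.
have iF : P.-integrable setT F.
  apply/integrableP; split=> //.
  under eq_integral do rewrite gee0_abs //.
  by apply: le_lt_trans intF _; rewrite ltry.
apply: filterS (integrable_ae measurableT iF) => w /(_ I) finF.
apply: cvg_series_cvg_0; apply: nondecreasing_is_cvgn.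
  exact: nondecreasing_series.
exists (fine (F w)) => _ [N _ <-] /=.
rewrite -lee_fin fineK // /series /= -sumEFin.
by apply: nneseries_lim_ge => k _ _; rewrite lee_fin.
Qed.

(** Normalised by [k ^ 2], the partial sum at [k ^ 2] has second moment at most [C ^+ 2 / k ^ 2],
    which is summable; [little_o_of_squares] fills the gaps. *)
Lemma orthogonal_lln (xi : nat -> T -> R) (C : R) :
  (forall k, measurable_fun setT (xi k)) ->
  (forall k w, `|xi k w| <= C) ->
  (forall k, \int[P]_w ((\sum_(i < k) xi i w) * xi k w) = 0) ->
  {ae P, forall w, forall e : R, 0 < e ->
    \forall k \near \oo, `|\sum_(i < k) xi i w| <= e * k%:R}.
Proof.
move=> mxi hC ho.
pose S k w := \sum_(i < k) xi i w.
have mS k : measurable_fun setT (S k) by apply: measurable_sum.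
have C0 : 0 <= C by apply: le_trans (hC 0%N point).
have hS k w : `|S k w| <= C * k%:R.
  apply: le_trans (ler_norm_sum _ _ _) _.
  rewrite (le_trans (y := \sum_(i < k) C)) ?ler_sum // sumr_const card_ord.
  by rewrite mulr_natr.
pose c k := (k.+1%:R ^- 4 : R).
have c0 k : 0 <= c k by rewrite invr_ge0 exprn_ge0.
pose f k w := c k * S (k.+1 ^ 2)%N w ^+ 2.
have mS2 k : measurable_fun setT (fun w => S k w ^+ 2) by exact: measurable_funX.
have mf k : measurable_fun setT (f k) by apply: measurable_funM.
have iS k : P.-integrable setT (EFin \o (fun w => S k w ^+ 2)).
  apply: (@bounded_integrable _ ((C * k%:R) ^+ 2)) => // w.
  by rewrite normrX lerXn2r ?nnegrE // mulr_ge0.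
have intf k : P.-integrable setT (EFin \o f k).
  exact: (integrableZl measurableT (c k) (iS (k.+1 ^ 2)%N)).
have := @ae_cvg0_of_summable_moments f (C ^+ 2 * 2) mf.
move=> /(_ _ intf) h; have {h} := h _ _.
have f0 k w : 0 <= f k w by rewrite mulr_ge0 // sqr_ge0.
have fB N : \sum_(k < N) \int[P]_w f k w <= C ^+ 2 * 2.
  apply: (@le_trans _ _ (\sum_(k < N) C ^+ 2 * (k.+1%:R ^+ 2)^-1)); last first.
    rewrite -mulr_sumr ler_wpM2l ?sqr_ge0 //.
    exact: sum_inv_squares_le.
  apply: ler_sum => k _; rewrite RintegralZl //.
  have a0 : k.+1%:R != 0 :> R by rewrite pnatr_eq0.
  have := second_moment_le mxi hC ho (k.+1 ^ 2)%N.
  move=> /(ler_wpM2l (c0 k)) /le_trans; apply.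
  by rewrite /c natrX le_eqVlt; apply/orP; left; apply/eqP; field.
move=> /(_ f0 fB); apply: filterS => w hw.
apply: (@little_o_of_squares R (fun k => S k w) C) => [k|e e0].
  by rewrite /S big_ord_recr /= addrAC subrr add0r.
have e20 : 0 < e ^+ 2 by rewrite exprn_gt0.
move/cvgrPdist_lt : hw => /(_ _ e20) [K _ hK].
exists K.+1 => // -[//|k] /= Kk.
have := hK k Kk; rewrite /= sub0r normrN ger0_norm // /f /c.
have a0 : 0 < k.+1%:R :> R by rewrite ltr0n.
rewrite mulrC ltr_pdivrMr ?exprn_gt0 // => h.
rewrite -ler_sqr ?nnegrE ?mulr_ge0 // ?(ltW e0) // -normrX ger0_norm ?sqr_ge0 //.
rewrite exprMn natrX -exprM; exact: ltW h.
Qed.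

End lln.

(** * Algebra of the AIMD matrices and of the response law *)

(* The vector beta-tilde in which exactly the agents in [S] drop. *)
Definition drop_vector (R : realType) (n : nat) (beta : 'cV[R]_n)
    (S : {set 'I_n}) : 'cV[R]_n :=
  \col_i (if i \in S then beta i 0 else 1).

Section aimd.
Context (R : realType) (n : nat) (alpha beta : 'cV[R]_n).
Context (hn : (2 <= n)%N).
Context (hab : aimd_parameters alpha beta).

Lemma alpha_gt0 i : 0 < alpha i 0.
Proof. by case: (alpha_ri hab). Qed.

Lemma alpha_sum : \sum_i alpha i 0 = 1.
Proof. by case: (alpha_ri hab) => [[]]. Qed.

Lemma beta_lt1 i : 0 < 1 - beta i 0.
Proof. by have := beta_itv hab i; lra. Qed.

Lemma alpha_lt1 i : alpha i 0 < 1.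
Proof.
have [j ji] : exists j : 'I_n, j != i.
  have : (0 < #|[set~ i]%SET|)%N by rewrite cardsC1 card_ord; lia.
  by rewrite card_gt0 => /set0Pn[j]; rewrite !inE => ?; exists j.
rewrite -alpha_sum (bigD1 i) //= ltrDl (bigD1 j) //=.
rewrite ltr_wpDr ?alpha_gt0 //; apply: sumr_ge0 => k _; exact/ltW/alpha_gt0.
Qed.

Lemma drop_vector_B S : aimd_B beta (drop_vector beta S).
Proof. by move=> i; rewrite mxE; case: ifP; [left | right]. Qed.

Lemma aimd_BE bt : aimd_B beta bt ->
  bt = drop_vector beta [set i | bt i 0 == beta i 0]%SET.
Proof.
move=> hb; apply/colP => i; rewrite mxE inE.
by case: eqP => // h; case: (hb i).
Qed.

(** For a dropping agent the diagonal entry is [1 - (1 - beta i 0) * (1 - alpha i 0)], below one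
    since [alpha i 0 < 1]. The matrix thus reveals who drops. *)
Lemma aimd_mx_diag S i :
  (aimd_mx alpha (drop_vector beta S) i i != 1) = (i \in S).
Proof.
rewrite /aimd_mx !mxE eqxx big_ord1 !mxE mulr1n.
have b1 := beta_lt1 i; have a1 := alpha_lt1 i; have b0 := beta_itv hab i.
case: ifP => _; last by rewrite subrr mulr0 addr0 eqxx.
apply/eqP => h.
have : (1 - beta i 0) * (1 - alpha i 0) = 0 by lra.
by move=> /eqP; rewrite mulf_eq0 => /orP[] /eqP; lra.
Qed.

(** Each dropping agent [j] releases the share [1 - beta j 0] of [v j 0], and the total released is
    redistributed according to [alpha]. *)
Lemma aimd_mx_mul (M : 'M[R]_n) (v : 'cV[R]_n) i : aimd_A alpha beta M ->
  (M *m v) i 0 = v i 0 - (1 - beta i 0) * ((M i i != 1)%:R * v i 0)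
    + alpha i 0 * \sum_j (1 - beta j 0) * ((M j j != 1)%:R * v j 0).
Proof.
move=> [bt hb <-]; rewrite (aimd_BE hb); set S := [set _ | _ ]%SET.
under [in RHS]eq_bigr do rewrite aimd_mx_diag.
rewrite aimd_mx_diag /aimd_mx mulmxDl -mulmxA mul_diag_mx !mxE big_ord1.
congr (_ + _).
  by case: ifP => _; rewrite ?mul1r ?mul0r; ring.
rewrite mxE; congr (_ * _); apply: eq_bigr => j _.
by rewrite !mxE; case: ifP => _; rewrite ?mul1r ?mul0r ?subrr ?mulr0 ?mul0r.
Qed.

Lemma aimd_mx_simplex (M : 'M[R]_n) (v : 'cV[R]_n) :
  aimd_A alpha beta M -> simplex v -> simplex (M *m v).
Proof.
move=> hM [v0 v1]; split=> [i|]; last first.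
  under eq_bigr do rewrite (aimd_mx_mul _ _ hM).
  by rewrite big_split /= sumrB -mulr_suml alpha_sum v1; ring.
rewrite (aimd_mx_mul _ _ hM).
have b1 := beta_lt1 i; have b0 := beta_itv hab i; have vi := v0 i.
apply: addr_ge0; last first.
  apply: mulr_ge0; first exact/ltW/alpha_gt0.
  by apply: sumr_ge0 => j _; rewrite !mulr_ge0 // ltW // beta_lt1.
rewrite mulrb; case: ifP => _; last by rewrite mul0r mulr0 subr0.
have : 0 <= beta i 0 * v i 0 by rewrite mulr_ge0 //; lra.
lra.
Qed.

(** After division by [1 - beta i 0] the redistributed amount carries the factor
    [alpha i 0 / (1 - beta i 0)], common to all agents, and cancels. *)
Lemma aimd_mx_drop_diff (M : 'M[R]_n) (v : 'cV[R]_n) i l :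
  aimd_A alpha beta M ->
  (M i i != 1)%:R * v i 0 - (M l l != 1)%:R * v l 0 =
  (v i 0 - (M *m v) i 0) / (1 - beta i 0)
  - (v l 0 - (M *m v) l 0) / (1 - beta l 0).
Proof.
move=> hM; rewrite !(aimd_mx_mul _ _ hM).
have r := alpha_beta_ratio hab i l.
set s := \sum_j _.
have e j : (v j 0 - (v j 0 - (1 - beta j 0) * ((M j j != 1)%:R * v j 0)
    + alpha j 0 * s)) / (1 - beta j 0) =
    (M j j != 1)%:R * v j 0 - alpha j 0 / (1 - beta j 0) * s.
  by field; rewrite lt0r_neq0 // beta_lt1.
by rewrite !e r; ring.
Qed.

Lemma response_prob_drop (lambda : 'I_n -> R -> R) (y : 'cV[R]_n) S :
  response_prob lambda beta (drop_vector beta S) y =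
  (\prod_(i in S) lambda i (y i 0)) *
  (\prod_(i | i \notin S) (1 - lambda i (y i 0))).
Proof.
rewrite /response_prob; congr (_ * _); apply: eq_bigl => i; rewrite mxE.
- case: ifP => _; first exact: eqxx.
  by apply/negbTE; rewrite eq_sym lt_eqF //; have := beta_lt1 i; lra.
- case: ifP => _; last exact: eqxx.
  by apply/negbTE; rewrite lt_eqF //; have := beta_lt1 i; lra.
Qed.

(** Expand [\prod_j (a j + b j)] over subsets: [b i = 0] removes those without [i], and every other
    factor equals one. *)
Lemma response_prob_sum (lambda : 'I_n -> R -> R) (y : 'cV[R]_n) i :
  \sum_(S : {set 'I_n} | i \in S)
    response_prob lambda beta (drop_vector beta S) y = lambda i (y i 0).
Proof.
pose a j := lambda j (y j 0); pose b j := if j == i then 0 else 1 - a j.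
have -> : lambda i (y i 0) = \prod_j (a j + b j).
  rewrite (bigD1 i) //= /b eqxx addr0 big1 ?mulr1 // => j /negbTE ->; ring.
rewrite bigA_distr /= [RHS](bigID (fun S : {set 'I_n} => i \in S)) /=.
rewrite [X in _ + X]big1 ?addr0; last first.
  move=> S iS; rewrite (bigD1 i) //= (negbTE iS) /b eqxx mul0r.
  done.
apply: eq_bigr => S iS; rewrite response_prob_drop.
rewrite [RHS](bigID (fun j => j \in S)) /=; congr (_ * _).
  by apply: eq_bigr => j ->.
apply: eq_bigr => j jS; rewrite (negbTE jS) /b.
by case: eqP => // ji; move: jS; rewrite ji iS.
Qed.

End aimd.

(** * Histories of a process *)

(** Recording the past as a single value turns conditioning on it into a partition by preimages of
    points. *)
Definition history (T V : Type) (z : nat -> T -> V) (k : nat) (w : T) : seq V :=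
  [seq z j w | j <- iota 0 k.+1].

Section history.
Context (T V : Type) (z : nat -> T -> V).

Lemma history_rcons k w : history z k.+1 w = rcons (history z k w) (z k.+1 w).
Proof. by rewrite /history -[k.+2]addn1 iotaD map_cat cats1. Qed.

Lemma last_history k w v : last v (history z k w) = z k w.
Proof. by case: k => [//|k]; rewrite history_rcons last_rcons. Qed.

Lemma eq_history k w w' : history z k w = history z k w' <->
  (forall j, (j <= k)%N -> z j w = z j w').
Proof.
split=> [h j jk|h].
  have := congr1 (fun s => nth (z j w) s j) h.
  by rewrite /history !(nth_map 0%N) ?size_iota ?nth_iota.
by apply/eq_in_map => j; rewrite mem_iota add0n ltnS => /andP[_ jk]; exact: h.
Qed.

End history.

(** * Measurability and conditional means for the chain *)

Section chain.
Context (R : realType) (n : nat) (alpha beta : 'cV[R]_n).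
Context (hn : (2 <= n)%N).
Context (hab : aimd_parameters alpha beta).
Context (lambda : 'I_n -> R -> R).
Context (hl : response_assumptions lambda).
Context (x0 xbar0 : 'cV[R]_n).
Context (hx0 : simplex x0).
Context (hxbar0 : simplex xbar0).
Context (d : measure_display) (T : measurableType d) (P : probability T R).
Context (A : nat -> T -> 'M[R]_n) (x xbar : nat -> T -> 'cV[R]_n).
Context (hchain : aimd_chain alpha beta lambda x0 xbar0 P A x xbar).

Let z k w := (x k w, xbar k w).
Let hist k w := history z k w.

Definition drop k i : set T := [set w | A k w i i != 1].

Lemma chain_averaged w :
  averaged_path (fun k j => x k w j 0) (fun k j => xbar k w j 0).
Proof.
have sx k : simplex (x k w).
  elim: k => [|k IH]; first by rewrite (chain_x0 hchain).
  rewrite (chain_x hchain); exact: (aimd_mx_simplex hn hab (chain_in hchain k w) IH).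
have rec k j : k.+2%:R * xbar k.+1 w j 0 =
    x k.+1 w j 0 + k.+1%:R * xbar k w j 0.
  rewrite (chain_xbar hchain) -(chain_x hchain) !mxE.
  have : k.+2%:R != 0 :> R by rewrite pnatr_eq0.
  by move: (k.+2%:R) => u u0; field.
have k0 k : 0 < k.+1%:R :> R by rewrite ltr0n.
have sb k : simplex (xbar k w).
  elim: k => [|k [IH0 IH1]]; first by rewrite (chain_xbar0 hchain).
  have [x0k x1k] := sx k.+1.
  split=> [j|].
    rewrite -(pmulr_rge0 _ (k0 k.+1)) rec addr_ge0 // mulr_ge0 //.
  apply: (mulfI (lt0r_neq0 (k0 k.+1))); rewrite mulr_sumr.
  under eq_bigr do rewrite rec.
  by rewrite big_split /= -mulr_sumr IH1 x1k !mulr1 -[k.+2]addn1 natrD addrC.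
split=> //.
- by move=> k j; case: (sx k).
- by move=> k; case: (sx k).
- by move=> k j; case: (sb k).
- by move=> k; case: (sb k).
Qed.

Lemma dropE k i : drop k i = \bigcup_(D in [set` [pred D : {set 'I_n} | i \in D]])
  (A k @^-1` [set aimd_mx alpha (drop_vector beta D)]).
Proof.
apply/seteqP; split=> w.
- rewrite /drop /= => h.
  have [bt hb e] := chain_in hchain k w.
  rewrite (aimd_BE hb) in e; exists (finset (fun i => bt i 0 == beta i 0)) => //=.
  by rewrite inE -(aimd_mx_diag hn hab) e.
- by case=> D; rewrite /= inE => iD e; rewrite /drop /= e (aimd_mx_diag hn hab).
Qed.

Lemma measurable_drop k i : measurable (drop k i).
Proof.
rewrite dropE; apply: fin_bigcup_measurable => [|D _]; first exact: finite_finset.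
exact: chain_measurable hchain _ _.
Qed.

Lemma drop_indic k j w : \1_(drop k j) w = (A k w j j != 1)%:R :> R.
Proof.
by rewrite indicE; congr (_ %:R); congr nat_of_bool; apply/idP/idP; rewrite inE.
Qed.

Lemma x_rec k w i : x k.+1 w i 0 = x k w i 0
  - (1 - beta i 0) * (\1_(drop k i) w * x k w i 0)
  + alpha i 0 * \sum_j (1 - beta j 0) * (\1_(drop k j) w * x k w j 0).
Proof.
rewrite (chain_x hchain) (aimd_mx_mul hn hab _ _ (chain_in hchain k w)) drop_indic.
by congr (_ + _ * _); apply: eq_bigr => j _; rewrite drop_indic.
Qed.

(** Induction through [x_rec]: the next state is polynomial in the current one and in the drop
    indicators, which are measurable as unions of events on [A k]. *)
Lemma measurable_x k i : measurable_fun setT (fun w => x k w i 0).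
Proof.
elim: k i => [|k IH] i.
  rewrite (_ : (fun w => _) = cst (x0 i 0)) //.
  by apply/funext => w; rewrite (chain_x0 hchain).
have mD j : measurable_fun setT (fun w => \1_(drop k j) w * x k w j 0 : R).
  apply: measurable_funM => //; exact: measurable_indic (measurable_drop k j).
rewrite (_ : (fun w => _) = (fun w => x k w i 0
  - (1 - beta i 0) * (\1_(drop k i) w * x k w i 0)
  + alpha i 0 * \sum_j (1 - beta j 0) * (\1_(drop k j) w * x k w j 0))); last first.
  by apply/funext => w; rewrite x_rec.
apply: measurable_funD.
  by apply: measurable_funB => //; exact: measurable_funM.
apply: measurable_funM => //; apply: measurable_sum => j.
exact: measurable_funM.
Qed.

Lemma measurable_xbar k i : measurable_fun setT (fun w => xbar k w i 0).
Proof.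
elim: k => [|k IH].
  rewrite (_ : (fun w => _) = cst (xbar0 i 0)) //.
  by apply/funext => w; rewrite (chain_xbar0 hchain).
rewrite (_ : (fun w => _) = (fun w => k.+2%:R^-1 * x k.+1 w i 0
  + k.+1%:R / k.+2%:R * xbar k w i 0)); last first.
  by apply/funext => w; rewrite (chain_xbar hchain) -(chain_x hchain) !mxE.
apply: measurable_funD; apply: measurable_funM => //; exact: measurable_x.
Qed.

Lemma measurable_response k i :
  measurable_fun setT (fun w => lambda i (xbar k w i 0)).
Proof.
have m01 : measurable (`[0, 1] : set R) by exact: measurable_itv.
(* Continuity of [lambda i] is known only within the unit interval, so the composition goes through
   that set, where the averages stay. *)
apply: (measurable_comp m01 (f := lambda i)).
- move=> _ [w _ <-] /=; rewrite in_itv /=; exact: (avg_itv (chain_averaged w)).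
- by apply: subspace_continuous_measurable_fun => //; exact: (@lambda_continuous _ _ _ hl i).
- exact: measurable_xbar.
Qed.

Lemma past_eventE k w0 :
  past_event x xbar k (fun j => z j w0) = hist k @^-1` [set hist k w0].
Proof. by apply/seteqP; split=> w /=; rewrite /hist eq_history. Qed.

Lemma measurable_past k w0 : measurable (hist k @^-1` [set hist k w0]).
Proof.
have mc (f : T -> R) c : measurable_fun setT f -> measurable [set w | f w = c].
  move=> mf; rewrite -[X in measurable X]setTI.
  exact: (mf measurableT [set c] (measurable_set1 c)).
rewrite -past_eventE.
have -> : past_event x xbar k (fun j => z j w0) =
    \bigcap_(j < k.+1) \bigcap_(i in [set: 'I_n])
      ([set w | x j w i 0 = x j w0 i 0] `&` [set w | xbar j w i 0 = xbar j w0 i 0]).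
  apply/seteqP; split=> w /= h j jk.
    by move=> i _; have [e1 e2] := h j jk; split; rewrite /= ?e1 ?e2.
  by rewrite /z; congr pair; apply/colP => i; have [] := h j jk i I.
apply: bigcap_measurable => [|j _]; first by exists 0%N.
apply: fin_bigcap_measurable => // i _.
by apply: measurableI; apply: mc; [exact: measurable_x | exact: measurable_xbar].
Qed.

(** Each history extends by one of the finitely many drop sets, so integrals split into finite sums
    over the past. *)
Lemma hist_finite k : exists2 s : seq (seq ('cV[R]_n * 'cV[R]_n)),
  uniq s & forall w, hist k w \in s.
Proof.
suff [s hs] : exists s : seq (seq ('cV[R]_n * 'cV[R]_n)), forall w, hist k w \in s.
  by exists (undup s) => [|w]; rewrite ?undup_uniq ?mem_undup.
elim: k => [|k [s hs]].
  exists [:: [:: (x0, xbar0)]] => w.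
  by rewrite /hist /history /= /z (chain_x0 hchain) (chain_xbar0 hchain) inE.
pose next (v : 'cV[R]_n * 'cV[R]_n) (S : {set 'I_n}) :=
  let y := aimd_mx alpha (drop_vector beta S) *m v.1 in
  (y, k.+2%:R^-1 *: y + (k.+1%:R / k.+2%:R) *: v.2).
exists [seq rcons h (next (last (x0, xbar0) h) D) | h <- s, D <- enum {set 'I_n}] => w.
have [bt hb e] := chain_in hchain k w.
rewrite (aimd_BE hb) in e; set S := finset _ in e.
apply/allpairsP; exists (hist k w, S); split; [exact: hs | by rewrite mem_enum | ].
rewrite [in RHS]/fst [in RHS]/snd.
rewrite /hist history_rcons; congr rcons; rewrite last_history /next.
by rewrite /z (chain_x hchain) (chain_xbar hchain) -e.
Qed.

(** Expresses measurability with respect to the past as constancy on its atoms, the fibres of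
    [hist k]. *)
Definition past_determined k (F : T -> R) := forall w w',
  (forall j, (j <= k)%N -> z j w = z j w') -> F w = F w'.

(** The drop event is the disjoint union over the drop sets containing [i]; [chain_law] applies to
    each, and [response_prob_sum] adds the weights. *)
Lemma past_drop k w0 i :
  fine (P (hist k @^-1` [set hist k w0] `&` drop k i)) =
  lambda i (xbar k w0 i 0) * fine (P (hist k @^-1` [set hist k w0])).
Proof.
have fP B : measurable B -> P B = (fine (P B))%:E.
  by move=> mB; rewrite fineK //; exact: fin_num_measure.
set H := hist k @^-1` _; have mH : measurable H := measurable_past k w0.
rewrite dropE setI_bigcupr measure_fin_bigcup //; last 2 first.
- move=> D D' _ _ [w [[_ eD] [_ eD']]]; rewrite /= in eD eD'.
  by apply/setP => j; rewrite -!(aimd_mx_diag hn hab) -eD -eD'.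
- by move=> D _; apply: measurableI => //; exact: chain_measurable hchain _ _.
rewrite -(@bigfs _ _ _ _ (index_enum {set 'I_n})) ?index_enum_uniq //; last first.
  by move=> D _; rewrite mem_index_enum.
rewrite -(response_prob_sum hab lambda (xbar k w0) i) mulr_suml.
have HE : H = past_event x xbar k (fun j => z j w0) by rewrite past_eventE.
have law D : P (H `&` A k @^-1` [set aimd_mx alpha (drop_vector beta D)]) =
    (response_prob lambda beta (drop_vector beta D) (xbar k w0) * fine (P H))%:E.
  rewrite EFinM -(fP _ mH) HE.
  exact: (chain_law hchain k (fun j => z j w0) (drop_vector_B beta D)).
rewrite (eq_bigr _ (fun D _ => law D)).
by rewrite sumEFin.
Qed.

(** The martingale difference property. On each fibre of the history [F] and the response are
    constant, and [past_drop] makes the integral vanish. *)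
Lemma past_determined_drop k i (F : T -> R) (C : R) :
  past_determined k F -> measurable_fun setT F -> (forall w, `|F w| <= C) ->
  \int[P]_w (F w * (\1_(drop k i) w - lambda i (xbar k w i 0))) = 0.
Proof.
move=> pF mF hF.
pose G w := F w * (\1_(drop k i) w - lambda i (xbar k w i 0)).
have mI : measurable_fun setT (\1_(drop k i) : T -> R).
  exact: measurable_indic (measurable_drop k i).
have mG : measurable_fun setT G.
  apply: measurable_funM => //; apply: measurable_funB => //.
  exact: measurable_response.
have l01 w : 0 <= lambda i (xbar k w i 0) <= 1.
  by apply: lambda_itv hl _ _ _; exact: (avg_itv (chain_averaged w)).
have iI : P.-integrable setT (EFin \o (\1_(drop k i) : T -> R)).
  exact: integrable_indic (measurable_drop k i).
have iG : P.-integrable setT (EFin \o G).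
  apply: (@bounded_integrable _ _ _ _ _ C) => // w.
  rewrite /G normrM -[leRHS]mulr1 ler_pM //.
  have := l01 w; rewrite indicE ler_norml; case: (w \in _) => /=; lra.
have [s us hs] := hist_finite k.
have setTE : [set: T] = \big[setU/set0]_(h <- s) (hist k @^-1` [set h]).
  by rewrite -bigcup_seq; apply/seteqP; split=> w // _; exists (hist k w); [exact: hs|].
have mH h : measurable (hist k @^-1` [set h]).
  have [[w0 <-]|nh] := pselect (exists w0, hist k w0 = h); first
    exact: measurable_past.
  rewrite (_ : _ @^-1` _ = set0) //; apply/seteqP; split=> w //= e.
  by apply: nh; exists w.
rewrite /Rintegral setTE integral_bigsetU_EFin //; last 2 first.
- exact: trivIset_preimage1.
- rewrite -setTE; exact/measurable_EFinP.
rewrite big1 //= => h _.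
have [[w0 <-]|nh] := pselect (exists w0, hist k w0 = h); last first.
  rewrite (_ : _ @^-1` _ = set0) ?integral_set0 //; apply/seteqP; split=> w //= e.
  by apply: nh; exists w.
set H := _ @^-1` _; have mHH : measurable H by exact: mH.
have iGH : P.-integrable H (EFin \o G) by exact: integrableS iG.
rewrite -[LHS]fineK; last exact: integrable_fin_num iGH.
congr EFin; rewrite -/(Rintegral P H G).
rewrite (@eq_Rintegral _ _ _ _ _
  (fun w => F w0 * (\1_(drop k i) w - lambda i (xbar k w0 i 0)))); last first.
  move=> w; rewrite inE => e; rewrite /G.
  have e' := (eq_history _ _ _ _).1 e.
  have [_ ->] := e' k (leqnn k); congr (_ * _); exact: pF.
have iIH : P.-integrable H (EFin \o (\1_(drop k i) : T -> R)) by exact: integrableS iI.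
have icst : P.-integrable H (EFin \o cst (lambda i (xbar k w0 i 0))).
  exact: finite_measure_integrable_cst.
rewrite RintegralZl //; last exact: (integrableB mHH iIH icst).
rewrite RintegralB // Rintegral_cst // /Rintegral integral_indic //;
  last exact: measurable_drop.
by rewrite setIC past_drop subrr mulr0.
Qed.

(* The state path does not determine the single terms [D_i x_i]: when all
   components of [x] are equal, nobody dropping and everybody dropping lead to
   the same next state.  Only the differences [D_i x_i - D_l x_l] are functions of
   the path, by [aimd_mx_drop_diff], which is what makes the partial sums
   past-determined. *)
Lemma response_difference_lln i l : {ae P, forall w, forall e : R, 0 < e ->
  \forall k \near \oo,
  `|cumulated_response lambda (fun k j => x k w j 0) (fun k j => xbar k w j 0) k i
    - cumulated_response lambda (fun k j => x k w j 0) (fun k j => xbar k w j 0) k l|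
  <= e * k%:R}.
Proof.
pose m i k w := x k w i 0 * (\1_(drop k i) w - lambda i (xbar k w i 0)).
pose xi k w := m i k w - m l k w.
have x01 k w j : 0 <= x k w j 0 <= 1 := path_itv (chain_averaged w) k j.
have l01 k w j : 0 <= lambda j (xbar k w j 0) <= 1.
  by apply: lambda_itv hl _ _ _; exact: (avg_itv (chain_averaged w)).
have mm j k : measurable_fun setT (m j k).
  apply: measurable_funM; first exact: measurable_x.
  apply: measurable_funB; last exact: measurable_response.
  exact: measurable_indic (measurable_drop k j).
have mxi k : measurable_fun setT (xi k) by exact: measurable_funB.
have bm j k w : `|m j k w| <= 1.
  rewrite /m normrM -[leRHS]mulr1 ler_pM //.
    by have := x01 k w j; rewrite ler_norml; lra.
  by have := l01 k w j; rewrite indicE ler_norml; case: (w \in _) => /=; lra.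
have bxi k w : `|xi k w| <= 2.
  by apply: le_trans (ler_normB _ _) _; have := bm i k w; have := bm l k w; lra.
pose b j := 1 - beta j 0.
have b0 j : 0 < b j by exact: beta_lt1 hab j.
have diffE k w : x k w i 0 * \1_(drop k i) w - x k w l 0 * \1_(drop k l) w =
    (x k w i 0 - x k.+1 w i 0) / b i - (x k w l 0 - x k.+1 w l 0) / b l.
  rewrite (chain_x hchain) -(aimd_mx_drop_diff hn hab _ _ _ (chain_in hchain k w)).
  by rewrite !drop_indic !(mulrC (x k w _ 0)).
have xiE k w : xi k w =
    ((x k w i 0 - x k.+1 w i 0) / b i - (x k w l 0 - x k.+1 w l 0) / b l)
    - (lambda i (xbar k w i 0) * x k w i 0 - lambda l (xbar k w l 0) * x k w l 0).
  by rewrite -diffE /xi /m; ring.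
pose S k w := \sum_(j < k) xi j w.
(* The drop differences telescope, so the martingale is a bounded boundary term minus the difference
   of cumulated responses. *)
have SE k w : S k w = (x0 i 0 - x k w i 0) / b i - (x0 l 0 - x k w l 0) / b l
    - (cumulated_response lambda (fun k j => x k w j 0) (fun k j => xbar k w j 0) k i
    - cumulated_response lambda (fun k j => x k w j 0) (fun k j => xbar k w j 0) k l).
  elim: k => [|k IH].
    by rewrite /S /cumulated_response !big_ord0 (chain_x0 hchain) !subrr !mul0r !subrr.
  rewrite /S /cumulated_response !big_ord_recr /= -/(S k w) IH xiE /cumulated_response.
  by ring.
(* The increment of index [j < k] involves states up to time [j.+1], still in the past at time
   [k]. *)
have pS k : past_determined k (S k).
  move=> w w' e; apply: eq_bigr => j _; rewrite !xiE.
  have [-> ->] := e j (ltnW (ltn_ord j)).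
  by have [-> _] := e j.+1 (ltn_ord j).
have mS k : measurable_fun setT (S k) by apply: measurable_sum.
have bS k w : `|S k w| <= 2 * k%:R.
  apply: le_trans (ler_norm_sum _ _ _) _.
  rewrite (le_trans (y := \sum_(i < k) 2)) ?ler_sum // sumr_const card_ord.
  by rewrite mulr_natr.
have ortho k : \int[P]_w (S k w * xi k w) = 0.
  have mSx j : measurable_fun setT (fun w => S k w * x k w j 0).
    by apply: measurable_funM => //; exact: measurable_x.
  have bSx j w : `|S k w * x k w j 0| <= 2 * k%:R.
    rewrite normrM -[leRHS]mulr1 ler_pM //.
    by have := x01 k w j; rewrite ler_norml; lra.
  have I0 j : \int[P]_w (S k w * m j k w) = 0.
    rewrite -[RHS](@past_determined_drop k j _ (2 * k%:R) _ (mSx j) (bSx j)).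
      by apply: eq_Rintegral => w _; rewrite /m mulrA.
    move=> w w' e; rewrite (pS k w w' e).
    by have [-> _] := e k (leqnn k).
  have iSm j : P.-integrable setT (EFin \o (fun w => S k w * m j k w)).
    apply: (@bounded_integrable _ _ _ _ _ (2 * k%:R)); first exact: measurable_funM.
    by move=> w; rewrite normrM -[leRHS]mulr1 ler_pM.
  under eq_Rintegral => w _ do rewrite /xi mulrBr.
  by rewrite RintegralB // !I0 subrr.
apply: filterS (orthogonal_lln mxi bxi ortho) => w hw e e0.
have e20 : 0 < e / 2 by lra.
pose g := (b i)^-1 + (b l)^-1.
(* The boundary terms are bounded by [g], which is below [e / 2 * k] once [k >= B]. *)
pose B := Num.bound (2 * g / e).
have g0 : 0 <= g by rewrite addr_ge0 // invr_ge0 ltW.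
have hB : 2 * g < B%:R * e.
  by rewrite -ltr_pdivrMr //; apply: archi_boundP; rewrite divr_ge0 ?mulr_ge0 // ltW.
have hBn : \forall k \near \oo, (B <= k)%N by exists B.
apply: filterS2 (hw _ e20) hBn => k; rewrite -/(S k w) SE => h Bk.
have Bk' : B%:R * e <= k%:R * e by rewrite ler_pM2r // ler_nat.
have bd j : `|(x0 j 0 - x k w j 0) / b j| <= (b j)^-1.
  rewrite normrM normfV (gtr0_norm (b0 j)) ler_piMl ?invr_ge0 ?(ltW (b0 j)) //.
  have := x01 k w j; have := x01 0%N w j; rewrite (chain_x0 hchain) ler_norml; lra.
move: h (bd i) (bd l); rewrite !ler_norml /g in hB *.
move: ((b i)^-1) ((b l)^-1) hB => p q hB.
move: ((x0 i 0 - _) * _) ((x0 l 0 - _) * _) => u v.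
by move=> /andP[? ?] /andP[? ?] /andP[? ?]; apply/andP; split; lra.
Qed.

End chain.

(** * Almost sure convergence of the averages *)

Unset Implicit Arguments.

Theorem theorem4p6 (R : realType) (n : nat) (hn : (2 <= n)%N)
    (alpha beta : 'cV[R]_n) (hab : aimd_parameters alpha beta)
    (lambda : 'I_n -> R -> R) (hlambda : response_assumptions lambda)
    (xs : 'cV[R]_n) (hxs : kkt_point lambda xs)
    (x0 xbar0 : 'cV[R]_n) (hx0 : simplex x0) (hxbar0 : simplex xbar0)
    (d : measure_display) (T : measurableType d) (P : probability T R)
    (A : nat -> T -> 'M[R]_n) (x xbar : nat -> T -> 'cV[R]_n)
    (hchain : aimd_chain alpha beta lambda x0 xbar0 P A x xbar) :
  {ae P, forall w, xbar k w @[k --> \oo] --> xs}.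
Proof.
have [[xs0 xs1] xsE] := hxs.
have i0 : 'I_n by exact: Ordinal (leq_trans (isT : (0 < 2)%N) hn).
have lln : {ae P, forall w, forall i l (e : R), 0 < e -> \forall k \near \oo,
  `|cumulated_response lambda (fun k j => x k w j 0) (fun k j => xbar k w j 0) k i
    - cumulated_response lambda (fun k j => x k w j 0) (fun k j => xbar k w j 0) k l|
  <= e * k%:R}.
  (* There are finitely many pairs of agents, so one null set serves them all. *)
  apply: filter_forall => i; apply: filter_forall => l.
  exact: (response_difference_lln hn hab hlambda hx0 hxbar0 hchain).
apply: filterS lln => w hw.
apply/cvgrPdist_lt => e e0.
have cv := averaged_cvg hlambda
  (chain_averaged hn hab hx0 hxbar0 hchain w) xs0 xs1 (fun j => xsE j i0) hw.
have : \forall k \near \oo, forall i, `|xbar k w i 0 - xs i 0| < e.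
  by apply: filter_forall => i; exact: cv.
apply: filterS => k hk.
rewrite [`|_|]mx_normrE; apply/bigmax_ltP; split=> // -[i j] _ /=.
by rewrite !mxE ord1 distrC.
Qed.
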